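(* Let $n,d$ be positive integers and let $\varphi$ be a form (homogeneous polynomial) of degree $d$ in $n$ real variables, $\varphi(x)=\sum_{\alpha\in\mathcal I_{n,d}}c_\alpha x^\alpha$ with $c_\alpha\in\mathbb R$, and put $c:=(c_{\alpha^1},\ldots,c_{\alpha^{s_{n,d}}})^\top$. Then a power-sum representation of $\varphi$ is given by $$\varphi(x)=\sum_{\alpha\in\mathcal I_{n,d}}\lambda_\alpha\langle\alpha,x\rangle^d\qquad\text{for all }x\in\mathbb R^n,$$ where $\lambda=(\lambda_{\alpha^1},\ldots,\lambda_{\alpha^{s_{n,d}}})^\top$ is the unique solution of the linear system $\widehat V(n,d)^\top\lambda=c$.
   Context: $\mathcal I_{n,d}=\{\alpha=(\alpha_1,\ldots,\alpha_n)\in\mathbb N^n:\sum_{i=1}^n\alpha_i=d\}$ with $\mathbb N=\{0,1,2,\ldots\}$; its cardinality is $s_{n,d}=\binom{n+d-1}{d}$, and its elements are enumerated in a fixed order as $\alpha^1,\ldots,\alpha^{s_{n,d}}$. For $x\in\mathbb R^n$, $x^\alpha=\prod_i x_i^{\alpha_i}$ (with $0^0=1$), and $\langle\cdot,\cdot\rangle$ is the standard inner product. The power-product matrix is the $s_{n,d}\times s_{n,d}$ matrix $$\widehat V(n,d)=\Big(\tbinom{d}{\alpha^j}(\alpha^i)^{\alpha^j}\Big)_{1\le i,j\le s_{n,d}},\qquad \tbinom{d}{\alpha^j}=\frac{d!}{\alpha^j_1!\cdots\alpha^j_n!},\qquad (\alpha^i)^{\alpha^j}=\prod_{k=1}^n(\alpha^i_k)^{\alpha^j_k},\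 0^0=1.$$ It is a known fact that $\widehat V(n,d)$ is nonsingular for all positive integers $n,d$. *)

(* Defs.v *)
From HB Require Import structures.
From mathcomp Require Import all_boot all_order all_algebra.
From mathcomp Require Import reals.
From mathcomp Require Import mpoly.

Set Implicit Arguments.
Unset Strict Implicit.
Unset Printing Implicit Defensive.

Import Order.TTheory GRing.Theory Num.Theory.

Local Open Scope ring_scope.

(* The cardinality s_{n,d} of I_{n,d} for n > 0. *)
Definition scard (n d : nat) : nat := 'C(n + d - 1, d).

(* The multi-indices of I_{n,d} are the a : 'X_{1..n} with mdeg a = d; an
   enumeration alpha^1, ..., alpha^s of I_{n,d} is a repetition-free tuple
   listing exactly these. *)
Definition enumerates (n d : nat) (alpha : (scard n d).-tuple 'X_{1..n}) : Prop :=
  uniq alpha /\ (forall a : 'X_{1..n}, (a \in alpha) = (mdeg a == d)).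

Lemma enumerates_exists (n d : nat) :
  (0 < n)%N -> exists alpha : (scard n d).-tuple 'X_{1..n}, enumerates alpha.
Proof.
case: n => [//|n] _; set s := [seq s2m t | t : d.-tuple 'I_n.+1 <- enum (basis n.+1 d)].
have hs : size s == scard n.+1 d.
  by rewrite /s size_basis /scard addSn subn1 /= addnC.
exists (Tuple hs); split; first exact: uniq_basis.
by move=> a; rewrite basis_cover.
Qed.

(* d! / (a_1! ... a_n!); the quotient is taken in the field R. *)
Definition multinomial (R : realType) (n d : nat) (a : 'X_{1..n}) : R :=
  d`!%:R / \prod_(k < n) (a k)`!%:R.

(* The entry a^b is the natural number \prod_k a_k ^ b_k, with 0 ^ 0 = 1. *)
Definition power_product_mx (R : realType) (n d : nat)
    (alpha : (scard n d).-tuple 'X_{1..n}) : 'M[R]_(scard n d) :=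
  \matrix_(i, j) (multinomial R d (tnth alpha j) *
                  (\prod_(k < n) tnth alpha i k ^ tnth alpha j k)%N%:R).

Definition coef_vec (R : realType) (n d : nat)
    (alpha : (scard n d).-tuple 'X_{1..n}) (phi : {mpoly R[n]}) :
    'cV[R]_(scard n d) :=
  \col_i phi@_(tnth alpha i).

Definition inner (R : realType) (n : nat) (u v : 'I_n -> R) : R :=
  \sum_(k < n) u k * v k.

(* Main.v *)
Require Import Defs.
From HB Require Import structures.
From mathcomp Require Import all_boot all_order all_algebra.
From mathcomp Require Import reals.
From mathcomp Require Import mpoly.

(** Expanding each power [<alpha, x>^d] by the multinomial theorem turns
    [\sum_alpha lambda_alpha <alpha, x>^d] into the form whose coefficient
    vector is [V^T lambda], where [V] is the power-product matrix; so a
    solution of [V^T lambda = c] yields a representation of the form with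
    coefficients [c]. What remains is that [V] is invertible.

    Up to the nonzero multinomial factors, column [j] of [V] lists the values of
    the monomial [x^(alpha^j)] at the points of I_{n,d}, so a right inverse of
    [V] amounts to a Lagrange basis: for each [a] in I_{n,d}, a form of degree
    [d] that vanishes at all points of I_{n,d} except [a]. With
    [s = x_1 + ... + x_n], such a form is
      [L_a(x) = \prod_k \prod_(j < a_k) (x_k - (j / d) s)].
    On I_{n,d} we have [s = d], so [L_a(b) = \prod_k b_k (b_k - 1) ... (b_k -
    a_k + 1)]. This is nonzero only if [a <= b] componentwise, which forces
    [a = b] because both have degree [d] ([meval_lagrange_form_neq] and
    [meval_lagrange_form_self]). *)

Set Implicit Arguments.
Unset Strict Implicit.
Unset Printing Implicit Defensive.

Import Order.TTheory GRing.Theory Num.Theory.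

Local Open Scope ring_scope.

Lemma prod_fact_neq0 (R : numDomainType) (n : nat) (a : 'X_{1..n}) :
  (\prod_(k < n) (a k)`!%:R : R) != 0.
Proof. by apply/prodf_neq0 => k _; rewrite pnatr_eq0 -lt0n fact_gt0. Qed.

Lemma multinomial_neq0 (R : realType) (n d : nat) (a : 'X_{1..n}) :
  multinomial R d a != 0.
Proof.
by rewrite mulf_neq0 ?invr_eq0 ?prod_fact_neq0 // pnatr_eq0 -lt0n fact_gt0.
Qed.

Lemma mderiv_exp (R : comNzRingType) (n : nat) (i : 'I_n) (p : {mpoly R[n]})
    (d : nat) :
  (p ^+ d.+1)^`M(i) = (p ^+ d * p^`M(i)) *+ d.+1.
Proof.
elim: d => [|d IHd]; first by rewrite !expr1 expr0 mul1r.
rewrite exprS mderivM IHd mulrnAr mulrA -exprS [_^`M(i) * _]mulrC.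
by rewrite -mulrS.
Qed.

Lemma mderiv_sumX (R : comNzRingType) (n : nat) (i : 'I_n) :
  (\sum_(k < n) 'X_k : {mpoly R[n]})^`M(i) = 1.
Proof.
rewrite raddf_sum (bigD1 i) //= mderivX mnm1E eqxx scale1r big1 => [|k ki].
  by rewrite -[X in (X - _)%MM]add0m addmK mpolyX0 addr0.
by rewrite mderivX mnm1E (negbTE ki) scale0r.
Qed.

Lemma dhomog_sumX (R : comNzRingType) (n : nat) :
  (\sum_(k < n) 'X_k : {mpoly R[n]}) \is 1.-homog.
Proof. by apply: rpred_sum => k _; rewrite dhomogX; apply/eqP/mdeg1. Qed.

(** The multinomial theorem, stated without division. With [s = \sum_k 'X_k],
    each partial derivative of [s ^+ d.+1] is [d.+1 * s ^+ d], so the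
    coefficients of successive powers of [s] determine each other: the one at
    [m + U_(i)], times [m i + 1], is [d.+1] times the one at [m]. *)
Lemma mcoeff_exp_sumX (R : comNzRingType) (n d : nat) (m : 'X_{1..n}) :
  mdeg m = d ->
  ((\sum_(k < n) 'X_k : {mpoly R[n]}) ^+ d)@_m *+ (\prod_(k < n) (m k)`!)%N
  = d`!%:R.
Proof.
elim: d m => [|d IHd] m.
  move/eqP; rewrite mdeg_eq0 => /eqP ->; rewrite expr0 mcoeff1 eqxx.
  by rewrite big1 // => k _; rewrite mnm0E.
move=> dm; have [i mi_gt0] : exists i, (0 < m i)%N.
  apply/existsP; apply: contra_eqT dm; rewrite negb_exists => /forallP m0.
  by rewrite mdegE big1 // => k _; apply/eqP; rewrite -leqn0 leqNgt m0.
have le_Um : (U_(i) <= m)%MM.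
  by apply/mnm_lepP => k; rewrite mnm1E; case: eqP => // <-.
have [m' def_m] : {m' | m = (m' + U_(i))%MM}.
  by exists (m - U_(i))%MM; rewrite submK.
have dm' : mdeg m' = d by move: dm; rewrite def_m mdegD mdeg1 addn1 => -[].
have fact_m : (\prod_(k < n) (m k)`! = (m' i).+1 * \prod_(k < n) (m' k)`!)%N.
  rewrite (bigD1 i) //= [in RHS](bigD1 i) //= def_m mnmDE mnm1E eqxx addn1.
  rewrite factS -mulnA; congr (_ * (_ * _))%N; apply: eq_bigr => k ki.
  by rewrite mnmDE mnm1E eq_sym (negbTE ki) addn0.
rewrite fact_m mulrnA def_m -mcoeff_deriv mderiv_exp mderiv_sumX mulr1.
by rewrite mcoeffMn mulrnAC IHd // -mulrnA mulnC -factS.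
Qed.

Lemma mcoeff_exp_sumX_multinomial (R : realType) (n d : nat) (m : 'X_{1..n}) :
  mdeg m = d ->
  ((\sum_(k < n) 'X_k : {mpoly R[n]}) ^+ d)@_m = multinomial R d m.
Proof.
move=> dm; rewrite /multinomial; apply: (canRL (mulfK (prod_fact_neq0 _ _))).
by rewrite -natr_prod mulr_natr mcoeff_exp_sumX.
Qed.

Lemma dhomog_bigprod (R : comNzRingType) (n : nat) (I : Type) (r : seq I)
    (e : I -> nat) (p : I -> {mpoly R[n]}) :
  (forall i, p i \is (e i).-homog) ->
  \prod_(i <- r) p i \is (\sum_(i <- r) e i)%N.-homog.
Proof.
move=> hp; apply: (big_ind2 (fun q k => q \is k.-homog)) => //.
- exact: dhomog1.
- by move=> q1 k1 q2 k2; exact: dhomogM.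
Qed.

Lemma meval_subset (R : comNzRingType) (n : nat) (r : seq 'X_{1..n})
    (p : {mpoly R[n]}) (x : 'I_n -> R) :
  uniq r -> {subset msupp p <= r} ->
  p.@[x] = \sum_(m <- r) p@_m * \prod_(k < n) x k ^+ m k.
Proof.
move=> ur sub; rewrite mevalE [RHS](bigID (fun m => m \in msupp p)) /=.
rewrite [X in _ + X]big1 ?addr0 => [|m /memN_msupp_eq0 ->]; last by rewrite mul0r.
rewrite -[RHS]big_filter; apply/perm_big/uniq_perm.
- exact: msupp_uniq.
- exact: filter_uniq.
- by move=> m; rewrite mem_filter; case: (boolP (m \in msupp p)) => // /sub.
Qed.

Lemma meval_dhomog (R : comNzRingType) (n d : nat)
    (alpha : (scard n d).-tuple 'X_{1..n}) (p : {mpoly R[n]}) (x : 'I_n -> R) :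
  enumerates alpha -> p \is d.-homog ->
  p.@[x] = \sum_(i < scard n d)
             p@_(tnth alpha i) * \prod_(k < n) x k ^+ tnth alpha i k.
Proof.
move=> [ualpha mem_alpha] /dhomogP hp; rewrite (meval_subset _ ualpha).
  exact: big_tuple.
by move=> m /hp /eqP; rewrite mem_alpha.
Qed.

Lemma inner_exp (R : realType) (n d : nat)
    (alpha : (scard n d).-tuple 'X_{1..n}) (u x : 'I_n -> R) :
  enumerates alpha ->
  inner u x ^+ d =
  \sum_(j < scard n d)
     multinomial R d (tnth alpha j)
     * (\prod_(k < n) u k ^+ tnth alpha j k)
     * \prod_(k < n) x k ^+ tnth alpha j k.
Proof.
move=> ealpha; have [_ mem_alpha] := ealpha.
have -> : inner u x = (\sum_(k < n) 'X_k : {mpoly R[n]}).@[fun k => u k * x k].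
  by rewrite raddf_sum; apply: eq_bigr => k _; rewrite /= mevalXU.
rewrite -rmorphXn /= (meval_dhomog _ ealpha); last first.
  by have := dhomogMn d (dhomog_sumX R n); rewrite mul1n.
apply: eq_bigr => j _; rewrite mcoeff_exp_sumX_multinomial; last first.
  by apply/eqP; rewrite -mem_alpha mem_tnth.
rewrite -mulrA -big_split /=; congr (_ * _).
by apply: eq_bigr => k _; rewrite exprMn.
Qed.

(** The term [(j / d) \sum_l 'X_l] is a homogeneous substitute for the constant
    [j]: it takes that value at every multi-index of degree [d]. *)
Definition lagrange_form (R : realType) (n d : nat) (a : 'X_{1..n}) :
    {mpoly R[n]} :=
  \prod_(k < n) \prod_(j < a k) ('X_k - (j%:R / d%:R) *: \sum_(l < n) 'X_l).

Lemma dhomog_lagrange_form (R : realType) (n d : nat) (a : 'X_{1..n}) :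
  lagrange_form R d a \is (mdeg a).-homog.
Proof.
rewrite mdegE; apply: dhomog_bigprod => k.
set q := \prod_(j < a k) _.
suff : q \is (\sum_(j < a k) 1)%N.-homog by rewrite sum1_card card_ord.
apply: dhomog_bigprod => j; apply: rpredB; first by rewrite dhomogX; apply/eqP/mdeg1.
exact/dhomogZ/dhomog_sumX.
Qed.

Lemma meval_lagrange_form (R : realType) (n d : nat) (a b : 'X_{1..n}) :
  (0 < d)%N -> mdeg b = d ->
  (lagrange_form R d a).@[fun k => (b k)%:R] =
  \prod_(k < n) \prod_(j < a k) ((b k)%:R - j%:R).
Proof.
move=> d_gt0 db; rewrite /lagrange_form rmorph_prod; apply: eq_bigr => k _.
rewrite rmorph_prod; apply: eq_bigr => j _.
rewrite /= mevalB mevalXU mevalZ raddf_sum /=.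
rewrite (eq_bigr (fun l => (b l)%:R)) => [|l _]; last by rewrite mevalXU.
by rewrite -natr_sum -mdegE db divfK // pnatr_eq0 -lt0n.
Qed.

Lemma meval_lagrange_form_self (R : realType) (n d : nat) (a : 'X_{1..n}) :
  (0 < d)%N -> mdeg a = d -> (lagrange_form R d a).@[fun k => (a k)%:R] != 0.
Proof.
move=> d_gt0 da; rewrite meval_lagrange_form //.
apply/prodf_neq0 => k _; apply/prodf_neq0 => j _.
by rewrite subr_eq0 eqr_nat gtn_eqF.
Qed.

(** Two distinct multi-indices of the same degree are incomparable, so
    [b k < a k] for some [k], and the factor with [j = b k] vanishes. *)
Lemma meval_lagrange_form_neq (R : realType) (n d : nat) (a b : 'X_{1..n}) :
  (0 < d)%N -> mdeg a = d -> mdeg b = d -> a != b ->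
  (lagrange_form R d a).@[fun k => (b k)%:R] = 0.
Proof.
move=> d_gt0 da db neq_ab; rewrite meval_lagrange_form //.
have [k lt_ba] : exists k, (b k < a k)%N.
  apply/existsP; apply: contra_neqT neq_ab; rewrite negb_exists => /forallP le_ab.
  have le : (a <= b)%MM by apply/mnm_lepP => k; rewrite leqNgt le_ab.
  have /eqP : mdeg (b - a)%MM = 0%N.
    by apply/eqP; rewrite -(eqn_add2r (mdeg a)) -mdegD submK // da db.
  by rewrite mdeg_eq0 => /eqP ba0; rewrite -(submK le) ba0 add0m.
by rewrite (bigD1 k) //= (bigD1 (Ordinal lt_ba)) //= subrr !mul0r.
Qed.

(** The right inverse has as columns the coefficient vectors of the forms
    [lagrange_form], scaled to take the value 1 at their own node; dividing by
    the multinomials cancels the factors attached to the columns of the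
    matrix. *)
Lemma power_product_mx_unit (R : realType) (n d : nat)
    (alpha : (scard n d).-tuple 'X_{1..n}) :
  (0 < d)%N -> enumerates alpha -> power_product_mx R alpha \in unitmx.
Proof.
move=> d_gt0 ealpha; have [ualpha mem_alpha] := ealpha.
have dalpha i : mdeg (tnth alpha i) = d.
  by apply/eqP; rewrite -mem_alpha mem_tnth.
pose L i := lagrange_form R d (tnth alpha i).
pose c i := (L i).@[fun k => (tnth alpha i k)%:R].
pose W : 'M[R]_(scard n d) := \matrix_(j, i)
  ((L i)@_(tnth alpha j) / (multinomial R d (tnth alpha j) * c i)).
suff /mulmx1_unit[] : power_product_mx R alpha *m W = 1%:M by [].
apply/matrixP => h i; rewrite !mxE.
have -> : \sum_j power_product_mx R alpha h j * W j i =
          (L i).@[fun k => (tnth alpha h k)%:R] / c i.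
  rewrite (meval_dhomog _ ealpha); last first.
    by have := dhomog_lagrange_form R d (tnth alpha i); rewrite dalpha.
  rewrite mulr_suml; apply: eq_bigr => j _; rewrite !mxE natr_prod.
  under [in LHS]eq_bigr => k _ do rewrite natrX.
  rewrite mulrAC [RHS]mulrAC; congr (_ * _).
  by rewrite invfM mulrCA mulVKf ?multinomial_neq0.
have [<-|neq_hi] := eqVneq h i; first by rewrite divff ?meval_lagrange_form_self.
rewrite meval_lagrange_form_neq ?mul0r //.
by apply: contraNneq neq_hi => /(tuple_uniqP _ ualpha) ->.
Qed.

Theorem lemma1 (R : realType) (n d : nat) (n_gt0 : (0 < n)%N) (d_gt0 : (0 < d)%N)
    (alpha : (scard n d).-tuple 'X_{1..n}) (alpha_enum : enumerates alpha)
    (phi : {mpoly R[n]}) (phi_form : phi \is d.-homog) :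
  exists lambda : 'cV[R]_(scard n d),
    [/\ (power_product_mx R alpha)^T *m lambda = coef_vec alpha phi,
        (forall mu : 'cV[R]_(scard n d),
           (power_product_mx R alpha)^T *m mu = coef_vec alpha phi -> mu = lambda)
      & forall x : 'I_n -> R,
          phi.@[x] =
          \sum_(i < scard n d)
             lambda i 0 * inner (fun k => (tnth alpha i k)%:R) x ^+ d].
Proof.
have Vunit : (power_product_mx R alpha)^T \in unitmx.
  by rewrite unitmx_tr power_product_mx_unit.
exists (invmx (power_product_mx R alpha)^T *m coef_vec alpha phi).
split=> [|mu <-|x]; [by rewrite mulKVmx | by rewrite mulKmx |].
set lambda := invmx _ *m _.
have Vlambda : (power_product_mx R alpha)^T *m lambda = coef_vec alpha phi.
  by rewrite mulKVmx.
under eq_bigr => i _ do rewrite (inner_exp _ _ alpha_enum) mulr_sumr.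
rewrite exchange_big (meval_dhomog _ alpha_enum phi_form) /=.
apply: eq_bigr => j _; under [RHS]eq_bigr => i _ do rewrite mulrA.
rewrite -mulr_suml; congr (_ * _).
have /matrixP/(_ j 0) := Vlambda; rewrite !mxE => <-.
apply: eq_bigr => i _; rewrite !mxE mulrC natr_prod; congr (_ * (_ * _)).
by apply: eq_bigr => k _; rewrite natrX.
Qed.
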